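(* Let $F=\{(x-a_i)^{e_i} : a_i\in\mathbb{K},\ e_i\in\mathbb{N},\ 1\le i\le s\}$. Then for any choice of parameters $(t,k,l)$ such that $$s(l+k+1) < (k+1)(l+1)+\frac{t(t-1)}{2},$$ there exists a shifted differential equation $\mathrm{SDE}(t,k',l)$ with $k'\le k$ which is satisfied simultaneously by the polynomials $f_i(x)=(x-a_i)^{e_i}$ for $i=1,\dots,s$.
   Context: $\mathbb{K}$ is a field of characteristic $0$, $\mathbb{N}$ contains $0$, and the pairs $(a_i,e_i)$ are pairwise distinct. The parameters $t,k,l$ are nonnegative integers. A shifted differential equation $\mathrm{SDE}(t,k,l)$ of parameters $(t,k,l)$ is a differential equation of the form $\sum_{i=0}^{k}P_i(x)f^{(i)}(x)=0$, where $f$ is the unknown function and the $P_i$ are polynomials in $\mathbb{K}[x]$ with $\deg(P_i)\le i+l$ for all $i\in\{0,\dots,t-1\}$, $\deg(P_i)\le l$ for all $i\in\{t,\dots,k\}$, and $P_k\neq 0$. The integer $k$ is called the order and $l$ the shift of the equation. The definition also covers the case $t>k$, in which the condition $\deg(P_i)\le i+l$ applies to every $i\in\{0,\dots,k\}$.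
   Formalization: The condition t ≤ k+1 is added: without it the claim fails, e.g. for k = l = 0, t = 2, s = 1, where the inequality reads 1 < 2 but a nonzero constant times (x-a)^e is never zero. *)

(* Defs.v *)
From HB Require Import structures.
From mathcomp Require Import all_boot all_order all_algebra.
Set Implicit Arguments.
Unset Strict Implicit.
Unset Printing Implicit Defensive.
Import GRing.Theory.
Local Open Scope ring_scope.

(* [P i] is the coefficient of the i-th derivative.  As [size p] is the degree
   plus one ([size 0 = 0]), [size p <= d.+1] says that [p] has degree at most
   [d], the zero polynomial included.  [k < t] is allowed; the second condition
   is then empty. *)
Definition SDE (K : fieldType) (t k l : nat) (P : 'I_k.+1 -> {poly K}) : Prop :=
  [/\ forall i : 'I_k.+1, (i < t)%N -> (size (P i) <= (i + l).+1)%N,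
      forall i : 'I_k.+1, (t <= i)%N -> (size (P i) <= l.+1)%N
    & P ord_max != 0].

Definition satisfies (K : fieldType) (k : nat) (P : 'I_k.+1 -> {poly K})
    (f : {poly K}) : Prop :=
  \sum_(i < k.+1) P i * f^`(i) = 0.

(* Main.v *)
Require Import Defs.
From mathcomp Require Import all_boot all_order all_algebra.
Import GRing.Theory.
Local Open Scope ring_scope.

(** The statement is a dimension count.  The coefficients of a family [P] with
    the prescribed degree bounds are
    [(k + 1)(l + 1) + (0 + 1 + ... + (t - 1))] free unknowns
    ([sum_coef_count], where [t <= k + 1] is used).  For a fixed [(a, e)] the
    equation satisfied by [(X - a) ^ e] is linear in them, but it has to be
    written with few scalar conditions: its degree alone would give about
    [l + e + 1] of them.  The remedy is that the [i]-th derivative of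
    [(X - a) ^ e] is [e ^_ i] times [(X - a) ^ (e - i)], so that, up to a power
    of [X - a], the left-hand side is
    [\sum_i e ^_ i (X - a) ^ (k - i) P_i] ([satisfies_reduced]).  Since
    [deg P_i <= i + l] for every [i], this reduced sum has degree at most
    [k + l], whatever [e] is: it vanishes as soon as [l + k + 1] linear forms
    do.  With fewer than [(k + 1)(l + 1) + t(t - 1) / 2] forms in total there is
    a nonzero [P]; cutting it at its last nonzero term gives order
    [k' <= k]. *)

Lemma exists_nonzero_solution (K : fieldType) (T S : finType)
    (A : T -> S -> K) :
  (#|S| < #|T|)%N ->
  exists2 u : T -> K, (exists x, u x != 0) &
    forall y, \sum_x u x * A x y = 0.
Proof.
move=> ltST.
pose M : 'M[K]_(#|T|, #|S|) := \matrix_(i, j) A (enum_val i) (enum_val j).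
have : kermx M != 0.
  rewrite kermx_eq0 /row_free neq_ltn (leq_ltn_trans _ ltST) //.
  exact: rank_leq_col.
move=> /rowV0Pn [v /sub_kermxP vM0 /rV0Pn [i0 vi0]].
exists (fun x => v 0 (enum_rank x)).
  by exists (enum_val i0); rewrite enum_valK.
move=> y; have := congr1 (fun w : 'rV_ _ => w 0 (enum_rank y)) vM0.
rewrite /= !mxE => vMy.
rewrite -[RHS]vMy (reindex (@enum_val T T)) /=; last first.
  by apply: onW_bij; apply: enum_val_bij.
by apply: eq_bigr => i _; rewrite mxE enum_valK enum_rankK.
Qed.

Lemma derivn_XsubC_exp (K : fieldType) (a : K) (e i : nat) :
  (('X - a%:P) ^+ e)^`(i) = ('X - a%:P) ^+ (e - i) *+ (e ^_ i).
Proof.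
elim: i => [|i IHi]; first by rewrite derivn0 subn0 ffactn0.
rewrite derivnS IHi derivMn deriv_exp derivXsubC mul1r -mulrnA.
by rewrite mulnC ffactnSr subnS.
Qed.

(** The reduced sum times [(X - a) ^ e] is the left-hand side of the
    differential equation times [(X - a) ^ k].  This factor avoids separating
    [e < k] from [k <= e]: the terms with [e < i] vanish on both sides because
    then [e ^_ i = 0]. *)
Lemma satisfies_reduced (K : fieldType) (k e : nat) (a : K)
    (P : 'I_k.+1 -> {poly K}) :
  \sum_(i < k.+1) (P i * ('X - a%:P) ^+ (k - i)) *+ (e ^_ i) = 0 ->
  satisfies P (('X - a%:P) ^+ e).
Proof.
move=> Q0; rewrite /satisfies; set L := (X in X = 0).
suff /eqP : ('X - a%:P) ^+ k * L = 0.
  by rewrite mulf_eq0 expf_eq0 polyXsubC_eq0 andbF => /eqP.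
have <- : ('X - a%:P) ^+ e *
    (\sum_(i < k.+1) (P i * ('X - a%:P) ^+ (k - i)) *+ (e ^_ i))
    = ('X - a%:P) ^+ k * L; last by rewrite Q0 mulr0.
rewrite /L !mulr_sumr; apply: eq_bigr => i _.
rewrite derivn_XsubC_exp -!mulrnAr.
case: (leqP i e) => [le_ie|lt_ei]; last first.
  by rewrite ffact_small // !mulr0n !mulr0.
rewrite mulrCA [RHS]mulrCA !mulrnAr -!exprD; congr (_ * _ ^+ _ *+ _).
by have le_ik := ltn_ord i; rewrite addnBA // addnBA // addnC.
Qed.

(** Both degree conditions of a shifted differential equation, as one bound on
    the size of the [i]-th coefficient; a size bound is also the dimension of
    the space of polynomials obeying it. *)
Definition coef_count (t l i : nat) : nat :=
  if (i < t)%N then (i + l).+1 else l.+1.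

Lemma coef_count_le (t l i : nat) : (coef_count t l i <= (i + l).+1)%N.
Proof. by rewrite /coef_count; case: ifP => // _; rewrite ltnS leq_addl. Qed.

Lemma sum_coef_count (t k l : nat) : (t <= k.+1)%N ->
  \sum_(i < k.+1) coef_count t l i
    = ((k + 1) * (l + 1) + (t * (t - 1)) %/ 2)%N.
Proof.
move=> le_tk; rewrite divn2 subn1 -bin2 -bin2_sum big_mkord.
rewrite (big_ord_widen _ (fun i => i) le_tk) [X in (_ + X)%N]big_mkcond /=.
have -> : ((k + 1) * (l + 1) = \sum_(i < k.+1) l.+1)%N.
  by rewrite sum_nat_const card_ord !addn1.
rewrite -big_split; apply: eq_bigr => i _; rewrite /coef_count /=.
by case: ifP => _; rewrite ?addn0 // addSn addnC.
Qed.

Section DimensionCount.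

Variables (K : fieldType) (s : nat) (a : 'I_s -> K) (e : 'I_s -> nat).
Variables (t k l : nat).

Let coefT : finType := {i : 'I_k.+1 & 'I_(coef_count t l i)}.

Let family (u : coefT -> K) (i : 'I_k.+1) : {poly K} :=
  \sum_(j < coef_count t l i) u (Tagged _ j) *: 'X^j.

Let coef_family u (i : 'I_k.+1) (j : 'I_(coef_count t l i)) :
  (family u i)`_j = u (Tagged _ j).
Proof.
rewrite coef_sum (bigD1 j) //= coefZ coefXn eqxx mulr1 big1 ?addr0 // => j' neq.
by rewrite coefZ coefXn -[_ == _]/(j == j') eq_sym (negbTE neq) mulr0.
Qed.

Let size_family u i : (size (family u i) <= coef_count t l i)%N.
Proof.
apply: (leq_trans (size_sum _ _ _)); apply/bigmax_leqP => j _.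
by apply: (leq_trans (size_scale_leq _ _)); rewrite size_polyXn.
Qed.

(** Only the coefficients of degree at most [l + k] of the reduced operators
    are imposed to vanish; the degree bound takes care of the others. *)
Lemma exists_common_family : (t <= k.+1)%N ->
    (s * (l + k + 1) < (k + 1) * (l + 1) + (t * (t - 1)) %/ 2)%N ->
  exists P : 'I_k.+1 -> {poly K},
    [/\ forall i, (size (P i) <= coef_count t l i)%N,
        exists i, P i != 0
      & forall n, satisfies P (('X - (a n)%:P) ^+ e n)].
Proof.
move=> le_tk hparam.
pose A (x : coefT) (y : 'I_s * 'I_(l + k + 1)) : K :=
  (('X^(tagged x) * ('X - (a y.1)%:P) ^+ (k - tag x)) *+ (e y.1 ^_ tag x))`_y.2.
have [|u [x ux] uA] := exists_nonzero_solution K coefT _ A.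
  rewrite card_prod !card_ord card_tagged sumnE big_map big_enum /=.
  by under eq_bigr do rewrite card_ord; rewrite sum_coef_count.
exists (family u); split=> //.
  exists (tag x); apply: contra_neq ux => P0.
  by case: x P0 => i j /= P0; rewrite -coef_family P0 coef0.
move=> n; apply: satisfies_reduced; apply/polyP => m; rewrite coef0.
case: (ltnP m (l + k + 1)) => [lt_m | le_m].
  rewrite -[RHS](uA (n, Ordinal lt_m)).
  transitivity (\sum_(i < k.+1) \sum_(j < coef_count t l i)
      u (Tagged _ j) * A (Tagged _ j) (n, Ordinal lt_m)); last first.
    by rewrite sig_big_dep; apply: eq_bigr => -[].
  rewrite coef_sum; apply: eq_bigr => i _.
  rewrite mulr_suml -sumrMnl coef_sum; apply: eq_bigr => j _.
  by rewrite /A /= -scalerAl scalerMnr coefZ.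
apply: nth_default; apply: leq_trans le_m.
apply: (leq_trans (size_sum _ _ _)); apply/bigmax_leqP => i _.
rewrite -scaler_nat; apply: (leq_trans (size_scale_leq _ _)).
apply: (leq_trans (size_polyMleq _ _)); rewrite size_exp_XsubC addnS /=.
have le_ik : (i <= k)%N by rewrite -ltnS.
apply: (@leq_trans ((i + l).+1 + (k - i))).
  by rewrite leq_add2r (leq_trans (size_family u i)) ?coef_count_le.
by rewrite addSn addn1 addnAC subnKC // addnC.
Qed.

End DimensionCount.

Lemma satisfies_truncate (K : fieldType) (k k' : nat) (le_k : (k'.+1 <= k.+1)%N)
    (P : 'I_k.+1 -> {poly K}) (f : {poly K}) :
  (forall i : 'I_k.+1, (k' < i)%N -> P i = 0) ->
  satisfies P f -> satisfies (fun i => P (widen_ord le_k i)) f.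
Proof.
move=> P0; rewrite /satisfies => satP; rewrite -[RHS]satP.
rewrite [RHS](bigID (fun i : 'I_k.+1 => (i < k'.+1)%N)) /=.
rewrite [X in _ = _ + X]big1 ?addr0 => [|i]; last first.
  by rewrite -leqNgt => /P0 ->; rewrite mul0r.
by rewrite (big_ord_narrow le_k).
Qed.

Theorem proposition2p2 (K : fieldType) (charK : [pchar K] =i pred0)
    (s : nat) (a : 'I_s -> K) (e : 'I_s -> nat)
    (ae_inj : injective (fun i => (a i, e i)))
    (t k l : nat) (le_tk : (t <= k.+1)%N)
    (hparam : (s * (l + k + 1) < (k + 1) * (l + 1) + (t * (t - 1)) %/ 2)%N) :
  exists k' : nat, (k' <= k)%N /\
    exists P : 'I_k'.+1 -> {poly K},
      SDE t l P /\ forall i : 'I_s, satisfies P (('X - (a i)%:P) ^+ e i).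
Proof.
have [P [sizeP [i0 Pi0] satP]]
  := exists_common_family K s a e t k l le_tk hparam.
have [m Pm maxm] := @arg_maxnP _ i0 (fun i => P i != 0) (fun i => i) Pi0.
exists m; split; first by rewrite -ltnS.
exists (fun i => P (widen_ord (ltn_ord m) i)); split; last first.
  move=> n; apply: satisfies_truncate (satP n) => i lt_mi.
  by apply: contraTeq lt_mi => /maxm; rewrite -leqNgt.
split=> [i lt_it | i le_ti |].
- by have := sizeP (widen_ord (ltn_ord m) i); rewrite /coef_count /= lt_it.
- by have := sizeP (widen_ord (ltn_ord m) i); rewrite /coef_count /= ltnNge le_ti.
- by rewrite (_ : widen_ord _ _ = m) //; apply: val_inj.
Qed.
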